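(* Let $\mathcal{A}$ be a unital complex $*$-algebra with a unital $*$-compatible linear functional $\Phi$, and let $X_1,\ldots,X_d\in\mathcal{A}^{sa}$ have joint distribution $\varphi$ on $\mathbb{C}\langle x_1,\ldots,x_d\rangle$, with moment generating function $M(\mathbf{z})$ and Boolean cumulant generating function $\eta(\mathbf{z})$. (a) The generating function for the Boolean Appell polynomials $A_{\vec u}(\mathbf{x})$ corresponding to $\varphi$ is $$H(\mathbf{x},\mathbf{z})=1+\sum_{|\vec u|\ge1}A_{\vec u}(\mathbf{x})z_{\vec u}=(1-\mathbf{x}\cdot\mathbf{z})^{-1}(1-\eta(\mathbf{z}))=(1-\mathbf{x}\cdot\mathbf{z})^{-1}(1+M(\mathbf{z}))^{-1}.$$ (b) The mutual expansions between monomials and Boolean Appell polynomials are, for all $n\ge1$ and $X_1,\ldots,X_n\in\mathcal{A}^{sa}$, $$A(X_1,X_2,\ldots,X_n)=X_1X_2\cdots X_n-\sum_{k=0}^{n-1}X_1\cdots X_k\;\eta[X_{k+1},\ldots,X_n]$$ and $$X_1X_2\cdots X_n=A(X_1,X_2,\ldots,X_n)+\sum_{k=0}^{n-1}A(X_1,\ldots,X_k)\;\Phi[X_{k+1}\cdots X_n].$$ (c) The Boolean Appell polynomials satisfy the recursion relation, for $X,X_1,\ldots,X_n\in\mathcal{A}^{sa}$, $$X\,A(X_1,X_2,\ldots,X_n)=A(X,X_1,X_2,\ldots,X_n)+\eta[X,X_1,X_2,\ldots,X_n].$$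
   Context: $\mathcal{A}^{sa}$ is the set of self-adjoint elements; $\Phi$ is $*$-compatible if $\Phi[X^*]=\overline{\Phi[X]}$. $\mathbb{C}\langle\mathbf{x}\rangle=\mathbb{C}\langle x_1,\ldots,x_d\rangle$ is the algebra of polynomials in non-commuting variables. Multi-indices are $\vec u\in\{1,\ldots,d\}^k$, $k\ge0$, $|\vec u|=k$; $x_{\vec u}=x_{u(1)}\cdots x_{u(k)}$. The joint distribution of $X_1,\ldots,X_d$ is the functional $\varphi[P(x_1,\ldots,x_d)]=\Phi[P(X_1,\ldots,X_d)]$. $\mathbf{z}=(z_1,\ldots,z_d)$ are non-commuting indeterminates, which commute with the $x_i$; $z_{\vec u}=z_{u(1)}\cdots z_{u(k)}$; $\mathbf{x}\cdot\mathbf{z}=\sum_ix_iz_i$; inverses are multiplicative inverses of formal power series in $\mathbf{z}$. $M(\mathbf{z})=\sum_{|\vec u|\ge1}\varphi[x_{\vec u}]z_{\vec u}$. The Boolean cumulant functional $\eta=\eta_\varphi$ is the linear functional on $\mathbb{C}\langle\mathbf{x}\rangle$ with $\eta[1]=0$ and, for $|\vec u|=n\ge1$, $\varphi[x_{\vec u}]=\sum_{\pi\in \mathrm{Int}(n)}\prod_{B\in\pi}\eta\big[\prod_{i\in B}x_{u(i)}\big]$, where $\mathrm{Int}(n)$ is the set of partitions of $\{1,\ldots,n\}$ into intervals; $\eta(\mathbf{z})=\sum_{|\vec u|\ge1}\eta[x_{\vec u}]z_{\vec u}$, equivalently $\eta(\mathbf{z})=1-(1+M(\mathbf{z}))^{-1}$.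 For elements of $\mathcal{A}^{sa}$, $\eta[X_1,\ldots,X_n]=\eta_\psi[x_1x_2\cdots x_n]$ where $\psi$ is the joint distribution of $X_1,\ldots,X_n$. $D_i$ is the linear operator on $\mathbb{C}\langle\mathbf{x}\rangle$ with $D_i1=0$, $D_ix_{\vec u}=\delta_{i,u(1)}x_{u(2)}\cdots x_{u(n)}$. The Boolean Appell polynomials $A_{\vec u}$ corresponding to $\varphi$ are the monic polynomial family (leading term $x_{\vec u}$, $A_\emptyset=1$) determined by $D_iA_{(j,\vec u)}=\delta_{ij}A_{\vec u}$ and $\varphi[A_{\vec u}]=\delta_{\vec u,\emptyset}$. For $X_1,\ldots,X_n\in\mathcal{A}^{sa}$, $A(X_1,\ldots,X_n)\in\mathcal{A}$ is the evaluation at $x_i=X_i$ of the polynomial $A_{(1,2,\ldots,n)}(x_1,\ldots,x_n)$ corresponding to the joint distribution of $X_1,\ldots,X_n$; $A(\emptyset)=1$. *)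

(* Defs.v *)
From HB Require Import structures.
From mathcomp Require Import all_boot all_order all_algebra.
From mathcomp Require classical_sets.
From mathcomp Require Import boolp reals.
From mathcomp Require Import complex finmap monalg.

Set Implicit Arguments.
Unset Strict Implicit.
Unset Printing Implicit Defensive.

Import Order.TTheory GRing.Theory Num.Theory.
Local Open Scope ring_scope.

Section StarAlgebra.
Context (K : numClosedFieldType) (A : algType K).

Definition star_involution (star : A -> A) : Prop :=
  [/\ {morph star : x y / x + y},
      forall c x, star (c *: x) = c^* *: star x,
      forall x y, star (x * y) = star y * star x
    & involutive star].

Definition star_compatible (star : A -> A) (Phi : A -> K) : Prop :=
  forall x, Phi (star x) = (Phi x)^*.

End StarAlgebra.

(* The free algebra K<x_1, ..., x_d>, as the monoid algebra of the free monoid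
   of words in the letters 'I_d. *)
Notation ncpoly K d := {malg K[{fmonom 'I_d}]}.

Section FreeAlgebra.
Context (K : comNzRingType) (d : nat).
Implicit Types (u v : seq 'I_d).

Definition mon u : ncpoly K d := << FMonom u >>.

Definition left_diff (i : 'I_d) : ncpoly K d -> ncpoly K d :=
  mmap (fun c => c%:MP)
    (fun w : {fmonom 'I_d} =>
       if w : seq 'I_d is j :: v then (i == j)%:R *: mon v else 0).

Definition nceval (A : lalgType K) (X : 'I_d -> A) : ncpoly K d -> A :=
  mmap (in_alg A) (fun w : {fmonom 'I_d} => \prod_(i <- (w : seq 'I_d)) X i).

End FreeAlgebra.

Section Cumulants.
Context (K : comNzRingType) (d : nat).
Implicit Types (phi eta : ncpoly K d -> K) (u : seq 'I_d).

Definition joint_distr (A : lalgType K) (Phi : A -> K) (X : 'I_d -> A) :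
    ncpoly K d -> K :=
  fun P => Phi (nceval X P).

Definition is_interval n (B : {set 'I_n}) : bool :=
  [forall i in B, forall k in B, forall j : 'I_n, (i <= j <= k)%N ==> (j \in B)].

Definition interval_partitions n : {set {set {set 'I_n}}} :=
  [set pi | partition pi [set: 'I_n] & [forall B in pi, is_interval B]].

(* enum B is increasing, so this is the word of the u(i), i in B, in order *)
Definition subword u (B : {set 'I_(size u)}) : seq 'I_d :=
  [seq tnth (in_tuple u) i | i <- enum B].

Record is_boolean_cumulant phi eta : Prop := IsBooleanCumulant {
  bc_linear : scalar eta;
  bc_one : eta 1 = 0;
  bc_moment : forall u, u != [::] ->
    phi (mon K u) = \sum_(pi in interval_partitions (size u))
                      \prod_(B in pi) eta (mon K (subword B)) }.

Definition boolean_cumulant phi : ncpoly K d -> K :=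
  classical_sets.xget (fun=> 0) (is_boolean_cumulant phi).

Record is_boolean_appell phi (a : seq 'I_d -> ncpoly K d) : Prop :=
  IsBooleanAppell {
  ba_nil : a [::] = 1;
  ba_monic : forall u (w : {fmonom 'I_d}),
    w \in msupp (a u - mon K u) -> (fdeg w < size u)%N;
  ba_diff : forall i j u, left_diff i (a (j :: u)) = (i == j)%:R *: a u;
  ba_mean : forall u, phi (a u) = (u == [::])%:R }.

Definition boolean_appell phi : seq 'I_d -> ncpoly K d :=
  classical_sets.xget (fun=> 0) (is_boolean_appell phi).

End Cumulants.

(* boolean_cumulant phi and, when phi is linear and unital, boolean_appell phi
   are the unique objects with their defining properties. *)
Section WellDefined.
Context (K : comNzRingType) (d : nat).
Implicit Types (phi eta : ncpoly K d -> K) (u v w : seq 'I_d).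

Lemma ncpoly_monE (P : ncpoly K d) :
  P = \sum_(w <- msupp P) P@_w *: mon K w.
Proof.
rewrite {1}[P]monalgE; apply: eq_bigr => w _; apply/malgP => k.
rewrite mcoeffZ !mcoeffU; case: w => w.
by case: eqP => _; rewrite ?mulr1 ?mulr0.
Qed.

Lemma mon_nil : mon K [::] = 1 :> ncpoly K d.
Proof. by rewrite /mon -fmoneE. Qed.

Lemma mon_cat u v : mon K (u ++ v) = mon K u * mon K v.
Proof. by rewrite /mon malgM_def fgmulUU mulr1 /mmul /= /fmmul fmE. Qed.

Lemma mmap_malg_linear (S : lalgType K) (h : {fmonom 'I_d} -> S) :
  linear (mmap (in_alg S) h).
Proof.
move=> c P Q; rewrite mmapD; congr (_ + _).
rewrite (mmapEw (msuppZ_le _ _)) mmapE scaler_sumr; apply: eq_bigr => w _.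
by rewrite mcoeffZ !mulr_algl scalerA.
Qed.

Lemma nceval_linear (A : lalgType K) (X : 'I_d -> A) : linear (nceval X).
Proof. exact: mmap_malg_linear. Qed.

Lemma nceval_mon (A : lalgType K) (X : 'I_d -> A) u :
  nceval X (mon K u) = \prod_(i <- u) X i.
Proof. by rewrite /nceval mmapU /= scale1r mul1r. Qed.

Lemma joint_distr_scalar (A : lalgType K) (Phi : {scalar A}) (X : 'I_d -> A) :
  scalar (joint_distr Phi X).
Proof. by move=> c P Q; rewrite /joint_distr nceval_linear linearP. Qed.

Lemma joint_distr1 (A : lalgType K) (Phi : A -> K) (X : 'I_d -> A) :
  Phi 1 = 1 -> joint_distr Phi X 1 = 1.
Proof. by rewrite /joint_distr -mon_nil nceval_mon big_nil. Qed.

Lemma left_diff_linear i : linear (@left_diff K d i).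
Proof.
move=> c P Q; rewrite /left_diff mmapD; congr (_ + _).
rewrite (mmapEw (msuppZ_le _ _)) mmapE scaler_sumr; apply: eq_bigr => w _.
by rewrite mcoeffZ !mul_malgC scalerA.
Qed.

Lemma left_diff_cons i j u :
  left_diff i (mon K (j :: u)) = (i == j)%:R *: mon K u.
Proof. by rewrite /left_diff mmapU mul1r. Qed.

Lemma left_diff1 i : left_diff i 1 = 0 :> ncpoly K d.
Proof. by rewrite -mon_nil /left_diff mmapU mulr0. Qed.

Lemma subwordT u : subword [set: 'I_(size u)] = u.
Proof.
rewrite /subword (eq_enum (B := 'I_(size u))) => [|i]; last by rewrite !inE.
by rewrite -[RHS](map_tnth_enum (in_tuple u)).
Qed.

Lemma size_subword u (B : {set 'I_(size u)}) : size (subword B) = #|B|.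
Proof. by rewrite /subword size_map -cardE. Qed.

Lemma interval_partitionT n : (0 < n)%N ->
  [set [set: 'I_n]] \in interval_partitions n.
Proof.
move=> n0; rewrite inE; apply/andP; split.
  rewrite /partition cover1 eqxx trivIset1 inE eq_sym.
  by apply/set0Pn; exists (Ordinal n0); rewrite inE.
by apply/'forall_implyP => B; rewrite inE => /eqP->; do 2![apply/forallP => ?;
  apply/implyP => _]; apply/forallP => j; rewrite inE implybT.
Qed.

Lemma partition_block_small n (pi : {set {set 'I_n}}) B :
  partition pi [set: 'I_n] -> pi != [set setT] -> B \in pi ->
  (0 < #|B| < n)%N.
Proof.
case/and3P => /eqP covpi /trivIsetP tpi pi0 piT Bpi.
have B0 : B != finset.set0 by apply: contraNneq pi0 => <-.
rewrite card_gt0 B0 /= -[X in (_ < X)%N]card_ord -cardsT.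
apply: proper_card; rewrite properT; apply: contraNneq piT => BT.
rewrite -BT eqEsubset sub1set Bpi andbT; apply/fintype.subsetP => C Cpi.
rewrite inE; apply/negPn/negP => CB; have := tpi _ _ Cpi Bpi CB.
rewrite BT -setI_eq0 setIT => /eqP C0; by rewrite -C0 Cpi in pi0.
Qed.

Fixpoint cumulant_fuel phi n u : K :=
  if n is n'.+1 then
    phi (mon K u) - \sum_(pi in interval_partitions (size u) | pi != [set setT])
      \prod_(B in pi) cumulant_fuel phi n' (subword B)
  else 0.

Lemma cumulant_fuelE phi n m u :
  (0 < size u)%N -> (size u <= n)%N -> (size u <= m)%N ->
  cumulant_fuel phi n u = cumulant_fuel phi m u.
Proof.
elim: n m u => [|n IH] [|m] u u0 un um //; try by rewrite ltnNge ?un ?um in u0.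
rewrite /=; congr (_ - _); apply: eq_bigr => pi /andP[piI piT].
move: piI; rewrite inE => /andP[piP _].
apply: eq_bigr => B Bpi; have := partition_block_small piP piT Bpi.
rewrite -size_subword => /andP[B0 Bu].
by apply: IH; rewrite // -ltnS (leq_trans Bu).
Qed.

Lemma is_boolean_cumulant_exists phi : exists eta, is_boolean_cumulant phi eta.
Proof.
pose c u := cumulant_fuel phi (size u) u.
pose eta := mmap idfun (fun w : {fmonom 'I_d} => c w).
have etaE u : eta (mon K u) = c u by rewrite /eta mmapU /= mul1r.
exists eta; split.
- move=> a P Q; rewrite /eta mmapD; congr (_ + _).
  rewrite (mmapEw (msuppZ_le _ _)) mmapE mulr_sumr; apply: eq_bigr => w _.
  by rewrite mcoeffZ mulrA.
- by rewrite -mon_nil etaE.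
- move=> u; rewrite -size_eq0 -lt0n => u0.
  rewrite (bigD1 [set setT]) ?interval_partitionT //= big_set1 etaE subwordT.
  rewrite /c (cumulant_fuelE _ (m := (size u).+1)) //= -[LHS](subrK (
    \sum_(pi in interval_partitions (size u) | pi != [set setT])
      \prod_(B in pi) cumulant_fuel phi (size u) (subword B))); congr (_ + _).
  apply: eq_bigr => pi /andP[piI piT]; move: piI; rewrite inE => /andP[piP _].
  apply: eq_bigr => B Bpi; have := partition_block_small piP piT Bpi.
  rewrite etaE -size_subword => /andP[B0 Bu].
  by apply: cumulant_fuelE; rewrite // ltnW.
Qed.

Lemma is_boolean_cumulant_inj phi eta eta' :
  is_boolean_cumulant phi eta -> is_boolean_cumulant phi eta' -> eta = eta'.
Proof.
case=> l1 o1 m1 [l2 o2 m2].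
have Esum f (P : ncpoly K d) : scalar f ->
    f P = \sum_(w <- msupp P) P@_w * f (mon K w).
  move=> lf; rewrite {1}[P]ncpoly_monE.
  have f0 : f 0 = 0.
    by have := lf (-1) 0 0; rewrite scaleN1r oppr0 addr0 mulN1r addNr.
  have fD : {morph f : x y / x + y}.
    by move=> x y; have := lf 1 x y; rewrite scale1r mul1r.
  rewrite (big_morph f fD f0); apply: eq_bigr => w _.
  by have := lf P@_w (mon K w) 0; rewrite f0 !addr0.
apply/funext => P; rewrite (Esum _ _ l1) (Esum _ _ l2); apply: eq_bigr => w _.
congr (_ * _); move: {w}(w : seq 'I_d) => w.
have [n] := ubnP (size w); elim: n w => // n IH w wn.
have [->|w0] := eqVneq w [::]; first by rewrite mon_nil o1 o2.
have := m1 _ w0; rewrite (m2 _ w0).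
have sw0 : (0 < size w)%N by rewrite lt0n size_eq0.
rewrite (bigD1 [set [set: 'I_(size w)]]) ?interval_partitionT //=.
rewrite [X in _ = X -> _](bigD1 [set [set: 'I_(size w)]]) ?interval_partitionT //=.
rewrite !big_set1 subwordT.
rewrite [X in _ = _ + X -> _](eq_bigr (fun pi : {set {set 'I_(size w)}} =>
  \prod_(B in pi) eta' (mon K (subword B)))) => [/addIr//|pi /andP[piI piT]].
move: piI; rewrite inE => /andP[piP _].
apply: eq_bigr => B Bpi; have := partition_block_small piP piT Bpi.
rewrite -size_subword => /andP[_ Bw]; apply: IH; exact: leq_trans Bw _.
Qed.

Lemma boolean_cumulantP phi : is_boolean_cumulant phi (boolean_cumulant phi).
Proof. exact: classical_sets.xgetPex (is_boolean_cumulant_exists phi). Qed.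

Lemma is_boolean_appell_exists phi : scalar phi -> phi 1 = 1 ->
  exists a, is_boolean_appell phi a.
Proof.
move=> lphi phi1.
pose a := fix a u : ncpoly K d := if u is j :: v then
  mon K [:: j] * a v - phi (mon K [:: j] * a v) *: 1 else 1.
have ldiffM (i j : 'I_d) (P : ncpoly K d) : left_diff i (mon K [:: j] * P) = (i == j)%:R *: P.
  have lD := left_diff_linear i.
  have D0 : left_diff i 0 = 0 :> ncpoly K d.
    by have := lD (-1) 0 0; rewrite scaleN1r oppr0 addr0 scaleN1r addNr.
  have DD : {morph @left_diff K d i : x y / x + y}.
    by move=> x y; have := lD 1 x y; rewrite !scale1r.
  rewrite [P]ncpoly_monE mulr_sumr (big_morph _ DD D0) scaler_sumr.
  apply: eq_bigr => w _.
  rewrite -mul_malgC mulrA.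
  have -> : mon K [:: j] * (P@_w)%:MP = (P@_w)%:MP * mon K [:: j].
    by rewrite /mon !malgM_def !fgmulUU mulm1 mul1m mulrC.
  rewrite -mulrA mul_malgC -mon_cat /= mul_malgC.
  have := lD P@_w (mon K (j :: w)) 0; rewrite D0 !addr0 => ->.
  by rewrite left_diff_cons !scalerA mulrC.
exists a; split=> //.
- elim=> [|j v IH] w /=; first by rewrite mon_nil subrr msupp0 in_fset0.
  rewrite (mon_cat [:: j] v) addrAC -mulrBr => /(fsubsetP (msuppB_le _ _)).
  rewrite in_fsetU.
  case/orP => [/msuppM_le[k1 [k2 [k1P k2P ->]]]|/(fsubsetP (msuppZ_le _ _))].
    have := IH _ k2P; rewrite /fdeg /mmul /= /fmmul fmE /= size_cat => k2v.
    move/(fsubsetP msuppU_le): k1P; rewrite in_fset1 => /eqP->.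
    by rewrite ltnS.
  move/(fsubsetP msuppU_le); rewrite in_fset1 => /eqP->.
  by rewrite /fdeg fm1.
- move=> i j u /=.
  by rewrite addrC -scaleNr left_diff_linear left_diff1 scaler0 add0r ldiffM.
- case=> [|j u] /=; first exact: phi1.
  by rewrite addrC -scaleNr lphi phi1 mulr1 addNr.
Qed.

Lemma is_boolean_appell_inj phi a a' : scalar phi -> phi 1 = 1 ->
  is_boolean_appell phi a -> is_boolean_appell phi a' -> a = a'.
Proof.
move=> lphi phi1 [n1 _ d1 m1] [n2 _ d2 m2]; apply/funext.
elim=> [|j u IH]; first by rewrite n1 n2.
pose P := a (j :: u) - a' (j :: u).
have DP (i : 'I_d) : left_diff i P = 0.
  rewrite /P -[X in X - _]scale1r -scaleN1r addrC left_diff_linear.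
  by rewrite scale1r d1 d2 IH scaleN1r addNr.
have coefD (i : 'I_d) (w : seq 'I_d) (Q : ncpoly K d) :
    (left_diff i Q)@_(FMonom w) = Q@_(FMonom (i :: w)).
  rewrite {2}[Q]monalgE /left_diff mmapE !raddf_sum; apply: eq_bigr => -[v] _ /=.
  rewrite mul_malgC mcoeffZ mcoeffU fmP.
  case: v => [|j' v]; first by rewrite mcoeff0 mulr0.
  rewrite mcoeffZ mcoeffU fmP eqseq_cons [j' == i]eq_sym -natrM mulnb.
  by rewrite mulr_natr.
have PE : P = P@_(FMonom [::]) *: 1.
  apply/malgP => -[[|i w]]; rewrite mcoeffZ mcoeff1 -val_eqE /= fm1 ?mulr1 //.
  by rewrite mulr0 -coefD DP mcoeff0.
apply/eqP; rewrite -subr_eq0 -/P PE.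
suff -> : P@_(FMonom [::]) = 0 by rewrite scale0r.
have := lphi P@_(FMonom [::]) 1 0; rewrite addr0 -PE phi1 mulr1.
have -> : phi 0 = 0.
  by have := lphi (-1) 0 0; rewrite scaleN1r oppr0 addr0 mulN1r addNr.
rewrite addr0 => <-; rewrite /P addrC -scaleN1r lphi m1 m2.
by rewrite mulN1r addNr.
Qed.

Lemma boolean_appellP phi : scalar phi -> phi 1 = 1 ->
  is_boolean_appell phi (boolean_appell phi).
Proof.
move=> lphi phi1; apply: classical_sets.xgetPex.
exact: is_boolean_appell_exists.
Qed.

End WellDefined.

(* The list s = [:: X_1; ...; X_n] is viewed as the family of its n entries;
   enum 'I_n is the word (1, ..., n). *)
Section ElementVersions.
Context (K : comNzRingType) (A : lalgType K) (Phi : A -> K).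

Definition seq_distr (s : seq A) : ncpoly K (size s) -> K :=
  joint_distr Phi (tnth (in_tuple s)).

Definition cumulant_of (s : seq A) : K :=
  boolean_cumulant (seq_distr (s := s)) (mon K (enum 'I_(size s))).

Definition appell_of (s : seq A) : A :=
  nceval (tnth (in_tuple s))
    (boolean_appell (seq_distr (s := s)) (enum 'I_(size s))).

End ElementVersions.

(* Formal power series in non-commuting indeterminates z_1, ..., z_d that
   commute with the coefficients; F u is the coefficient of z_u. *)
Definition ncseries (d : nat) (B : nzRingType) : Type := seq 'I_d -> B.

HB.instance Definition _ d B := Choice.copy (ncseries d B) (seq 'I_d -> B).

Section SeriesRing.
Context (d : nat) (B : nzRingType).
Implicit Types (F G H : ncseries d B) (u : seq 'I_d).

Definition series_opp F : ncseries d B := fun u => - F u.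
Definition series_add F G : ncseries d B := fun u => F u + G u.
Definition series_const (b : B) : ncseries d B :=
  fun u => if u is [::] then b else 0.
Definition series_mul F G : ncseries d B :=
  fun u => \sum_(k < (size u).+1) F (take k u) * G (drop k u).

Fact series_addA : associative series_add.
Proof. by move=> F G H; apply/funext => u; rewrite /series_add addrA. Qed.
Fact series_addC : commutative series_add.
Proof. by move=> F G; apply/funext => u; rewrite /series_add addrC. Qed.
Fact series_add0 : left_id (series_const 0) series_add.
Proof. by move=> F; apply/funext; case=> [|i u]; rewrite /series_add add0r. Qed.
Fact series_addN : left_inverse (series_const 0) series_opp series_add.
Proof.
by move=> F; apply/funext; case=> [|i u]; rewrite /series_add /series_opp addNr.
Qed.

HB.instance Definition _ := GRing.isZmodule.Build (ncseries d B)
  series_addA series_addC series_add0 series_addN.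

Fact series_mul_nil F G : series_mul F G [::] = F [::] * G [::].
Proof. by rewrite /series_mul big_ord_recl big_ord0 addr0. Qed.

Fact series_mul_cons F G i u : series_mul F G (i :: u) =
  F [::] * G (i :: u) + series_mul (fun v => F (i :: v)) G u.
Proof. by rewrite /series_mul big_ord_recl. Qed.

Fact series_mul1 : left_id (series_const 1) series_mul.
Proof.
move=> F; apply/funext => u; rewrite /series_mul big_ord_recl take0 drop0 mul1r.
by rewrite big1 ?addr0 // => k _; case: u k => [|i u] [] //= k kP; rewrite mul0r.
Qed.

Fact series_1mul : right_id (series_const 1) series_mul.
Proof.
move=> F; apply/funext => u.
rewrite /series_mul big_ord_recr /= take_size drop_size mulr1 big1 ?add0r // => k _.
have := size_drop k u; case: (drop k u) => [/esym/eqP|i v _]; last by rewrite mulr0.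
by rewrite subn_eq0 leqNgt ltn_ord.
Qed.

Fact series_mulDl : left_distributive series_mul series_add.
Proof.
move=> F G H; apply/funext => u; rewrite /series_add /series_mul -big_split /=.
by apply: eq_bigr => k _; rewrite mulrDl.
Qed.

Fact series_mulDr : right_distributive series_mul series_add.
Proof.
move=> F G H; apply/funext => u; rewrite /series_add /series_mul -big_split /=.
by apply: eq_bigr => k _; rewrite mulrDr.
Qed.

Fact series_mulA : associative series_mul.
Proof.
move=> F G H; apply/funext => u.
elim: u F G => [|i u IH] F G; first by rewrite !series_mul_nil mulrA.
rewrite !series_mul_cons series_mul_nil IH mulrDr mulrA -addrA; congr (_ + _).
have -> : (fun v => series_mul F G (i :: v)) = series_add
    (fun v => F [::] * G (i :: v)) (series_mul (fun v => F (i :: v)) G).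
  by apply/funext => v; rewrite series_mul_cons.
rewrite series_mulDl /series_add; congr (_ + _).
by rewrite /series_mul mulr_sumr; apply: eq_bigr => k _; rewrite mulrA.
Qed.

Fact series_1neq0 : series_const 1 != 0 :> ncseries d B.
Proof. by apply/eqP => /(congr1 (@^~ [::]))/eqP; rewrite oner_eq0. Qed.

HB.instance Definition _ := GRing.Zmodule_isNzRing.Build (ncseries d B)
  series_mulA series_mul1 series_1mul series_mulDl series_mulDr series_1neq0.

Definition series_unit : {pred ncseries d B} :=
  [pred F | `[< exists G, G * F = 1 /\ F * G = 1 >]].
Definition series_inv F : ncseries d B :=
  classical_sets.xget F (fun G => G * F = 1 /\ F * G = 1).

Fact series_invP F : F \in series_unit ->
  series_inv F * F = 1 /\ F * series_inv F = 1.
Proof.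
rewrite inE => /asboolP[G GF].
exact: (@classical_sets.xgetI _ F (fun G => G * F = 1 /\ F * G = 1) G GF).
Qed.
Fact series_mulVr : {in series_unit, left_inverse 1 series_inv *%R}.
Proof. by move=> F /series_invP[]. Qed.
Fact series_mulrV : {in series_unit, right_inverse 1 series_inv *%R}.
Proof. by move=> F /series_invP[]. Qed.
Fact series_unitP F G : G * F = 1 /\ F * G = 1 -> F \in series_unit.
Proof. by move=> GF; rewrite inE; apply/asboolP; exists G. Qed.
Fact series_inv_out : {in [predC series_unit], series_inv =1 id}.
Proof.
move=> F; rewrite !inE => /asboolPn nF; rewrite /series_inv.
by case: classical_sets.xgetP => // G _ GF; case: nF; exists G.
Qed.

HB.instance Definition _ := GRing.NzRing_hasMulInverse.Build (ncseries d B)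
  series_mulVr series_mulrV series_unitP series_inv_out.

Lemma series_coefD F G u : (F + G) u = F u + G u.
Proof. by []. Qed.
Lemma series_coefN F u : (- F) u = - F u.
Proof. by []. Qed.
Lemma series_coef0 u : (0 : ncseries d B) u = 0.
Proof. by case: u. Qed.
Lemma series_coef1 u : (1 : ncseries d B) u = (u == [::])%:R.
Proof. by case: u. Qed.
Lemma series_coefM F G u :
  (F * G) u = \sum_(k < (size u).+1) F (take k u) * G (drop k u).
Proof. by []. Qed.

Definition series_coefE :=
  (series_coefD, series_coefN, series_coef0, series_coef1).

Lemma series_sumE (I : Type) (r : seq I) (P : pred I) (f : I -> ncseries d B) u :
  (\sum_(i <- r | P i) f i) u = \sum_(i <- r | P i) f i u.
Proof.
apply: (big_morph (fun F : ncseries d B => F u)) => [F G|];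
  by rewrite series_coefE.
Qed.

Lemma series_expr_eq0 F n u : F [::] = 0 -> (size u < n)%N -> (F ^+ n) u = 0.
Proof.
move=> F0; elim: n u => // n IH u un; rewrite exprS series_coefM big1 // => k _.
case: k => -[|k] kP /=; first by rewrite take0 F0 mul0r.
rewrite IH ?mulr0 // size_drop; case: u un kP => //= i u un kP.
by rewrite subSS (leq_ltn_trans (leq_subr _ _)).
Qed.

(* Hence 1 - x.z and 1 + M(z) below do have multiplicative inverses. *)
Lemma series_unit_const1 F : F [::] = 1 -> F \is a GRing.unit.
Proof.
move=> F1; pose N : ncseries d B := 1 - F.
have N0 : N [::] = 0 by rewrite /N !series_coefE F1 subrr.
pose S n : ncseries d B := \sum_(m < n) N ^+ m.
pose G : ncseries d B := fun u => S (size u).+1 u.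
have GS n u : (size u < n)%N -> G u = S n u.
  move=> un; rewrite /G /S !series_sumE -(subnKC un) big_split_ord /=.
  rewrite [X in _ + X]big1 ?addr0 // => k _; apply: series_expr_eq0 => //.
  by rewrite leq_addr.
have FN : F = 1 - N by rewrite /N opprB addrC subrK.
have FS n : F * S n = 1 - N ^+ n.
  by rewrite -[RHS]opprB subrX1 -mulNr -/(S n) [in LHS]FN [in RHS]opprB.
have SF n : S n * F = 1 - N ^+ n.
  rewrite -FS; apply: commr_sym; apply: commr_sum => k _; apply: commrX.
  by rewrite FN; apply: commr_sym; apply: commrB => //; apply: commr1.
apply/unitrP; exists G; split; apply/funext => u.
  transitivity ((S (size u).+1 * F) u).
    rewrite !series_coefM; apply: eq_bigr => k _; rewrite (GS (size u).+1) //.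
    by rewrite ltnS size_take_min geq_minr.
  by rewrite SF !series_coefE series_expr_eq0 // subr0.
transitivity ((F * S (size u).+1) u).
  rewrite !series_coefM; apply: eq_bigr => k _; rewrite (GS (size u).+1) //.
  by rewrite ltnS size_drop leq_subr.
by rewrite FS !series_coefE series_expr_eq0 // subr0.
Qed.

Definition zvar (i : 'I_d) : ncseries d B := fun u => (u == [:: i])%:R.

(* \sum_(|u| >= 1) c_u z_u *)
Definition gen_series (c : seq 'I_d -> B) : ncseries d B :=
  fun u => if u is [::] then 0 else c u.

End SeriesRing.

(* Scalar series are regarded as series over K<x> through constant polynomials. *)
Section GeneratingFunctions.
Context (K : comNzRingType) (d : nat) (phi : ncpoly K d -> K).

Definition moment_series : ncseries d (ncpoly K d) :=
  gen_series (fun u => (phi (mon K u))%:MP).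

Definition cumulant_series : ncseries d (ncpoly K d) :=
  gen_series (fun u => (boolean_cumulant phi (mon K u))%:MP).

Definition appell_series : ncseries d (ncpoly K d) :=
  1 + gen_series (boolean_appell phi).

Definition x_dot_z : ncseries d (ncpoly K d) :=
  \sum_(i < d) series_const (mon K [:: i]) * zvar (ncpoly K d) i.

End GeneratingFunctions.

Arguments x_dot_z {K d}.

(* Main.v *)
From HB Require Import structures.
Require Import Defs.
From mathcomp Require Import all_boot all_order all_algebra.
From mathcomp Require Import reals complex monalg.
From mathcomp Require Import boolp.

(** Everything rests on one identity: in the series ring,
    (1 + M(z)) (1 - eta(z)) = 1. It says that a moment is obtained by choosing
    the last block of an interval partition (a final segment of the word),
    weighting it by its cumulant, and weighting the remaining initial segment
    by its moment ([moment_last_block]). Since 1 + M has constant term 1, it is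
    a unit, so the one-sided identity gives (1 + M)^-1 = 1 - eta and hence also
    (1 - eta) (1 + M) = 1, the expansion by the first block, which therefore
    needs no separate combinatorial argument.

    The inverse of 1 - x.z is the geometric series, whose coefficient at z_u is
    the word x_u itself. So the coefficient of (1 - x.z)^-1 (1 - eta) at z_u is
      x_u - sum_(k < |u|) eta[x_(drop k u)] x_(take k u).
    This family satisfies the properties that characterize the Boolean Appell
    polynomials: the left derivative D_i strips the first letter of every term
    and kills the k = 0 term, which is constant, while the mean vanishes by the
    last-block identity ([is_boolean_appell_expand]). This proves (a)
    and, by evaluation at the X_i, the first expansion of (b). Multiplying
    H = (1 - x.z)^-1 (1 + M)^-1 on the right by 1 + M and comparing coefficients
    gives the second expansion ([mon_appell_expand]), and (c) is the comparison
    of the first expansion for X_1 ... X_n with the one for X X_1 ... X_n.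

    The list versions in (b) and (c) use a different free algebra for every
    length of list. They can be compared because the last-block identity
    determines the cumulant of a word recursively from the moments of its
    subwords, so a cumulant depends only on the list of elements of the algebra
    that the word evaluates to ([boolean_cumulant_word]). *)

Set Implicit Arguments.
Unset Strict Implicit.
Unset Printing Implicit Defensive.

Import Order.TTheory GRing.Theory Num.Theory.
Local Open Scope ring_scope.

(** * The last block of an interval partition *)

Section LastBlock.
Context (n : nat).
Implicit Types (pi : {set {set 'I_n}}) (B : {set 'I_n}) (i j k l : nat).

Definition ord_segment l k : {set 'I_n} := [set i : 'I_n | (l <= i < k)%N].

(** Partitions of an initial segment are kept inside the fixed type 'I_n, so that
    removing a block needs no reindexing. *)
Definition initial_interval_partitions k : {set {set {set 'I_n}}} :=
  [set pi | partition pi (ord_segment 0 k) & [forall B in pi, is_interval B]].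

Lemma ord_segment_is_interval l k : is_interval (ord_segment l k).
Proof.
apply/forallP => i; apply/implyP; rewrite inE => /andP[li _].
apply/forallP => j; apply/implyP; rewrite inE => /andP[_ jk].
apply/forallP => h; apply/implyP => /andP[ih hj].
by rewrite inE (leq_trans li ih) (leq_ltn_trans hj jk).
Qed.

Lemma is_intervalP B : is_interval B ->
  forall a b c : 'I_n, a \in B -> c \in B -> (a <= b <= c)%N -> b \in B.
Proof.
move=> + a b c aB cB abc; move=> /forallP/(_ a)/implyP/(_ aB)/forallP/(_ c).
by move=> /implyP/(_ cB)/forallP/(_ b)/implyP/(_ abc).
Qed.

(** The last block is the one containing the maximal index k. It is convex, so it
    runs from its least element up to k, and disjointness makes it unique. *)
Lemma last_block_exists pi k : (k < n)%N ->
  pi \in initial_interval_partitions k.+1 ->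
  exists2 l : 'I_k.+1, ord_segment l k.+1 \in pi
    & forall l' : 'I_k.+1, ord_segment l' k.+1 \in pi -> l' = l.
Proof.
move=> kn; rewrite inE => /andP[piP /forallP piI].
have /and3P[/eqP cov triv _] := piP.
pose a := Ordinal kn.
have aD : a \in cover pi by rewrite cov inE /=.
have Bpi : pblock pi a \in pi by rewrite pblock_mem.
have aB : a \in pblock pi a by rewrite mem_pblock.
have := piI (pblock pi a); rewrite Bpi /= => /is_intervalP BI.
have [m mB mmin] := arg_minnP (fun i : 'I_n => i : nat) aB.
have mk : (m < k.+1)%N by rewrite ltnS (mmin a).
have BE : pblock pi a = ord_segment m k.+1.
  apply/setP => i; rewrite inE; apply/idP/idP => [iB|/andP[mi ik]].
    have := fintype.subsetP (partitionS piP Bpi) _ iB.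
    by rewrite inE => /andP[_ ->]; rewrite (mmin i).
  by apply: (BI m _ a); rewrite // mi.
exists (Ordinal mk) => [|l' l'pi]; first by rewrite -BE.
have aS : a \in ord_segment l' k.+1 by rewrite inE /= ltnSn leq_ord.
have := def_pblock triv l'pi aS; rewrite BE => /setP SE.
have l'n : (l' < n)%N by rewrite (leq_trans (ltn_ord l')).
have ml' : (m <= l')%N.
  have := SE (Ordinal l'n); rewrite !inE /= leqnn ltn_ord /=.
  by case/andP.
have l'm : (l' <= m)%N.
  by have := SE m; rewrite !inE leqnn mk /= andbT => <-.
by apply/val_inj/eqP; rewrite eqn_leq l'm ml'.
Qed.

Lemma add_last_block pi l k : (l < k)%N -> (k <= n)%N ->
  pi \in initial_interval_partitions l ->
  ord_segment l k \notin pi /\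
  ord_segment l k |: pi \in initial_interval_partitions k.
Proof.
move=> lk kn; rewrite inE => /andP[piP /forallP piI].
have ln := leq_trans lk kn.
have S0 : ord_segment l k != set0.
  by apply/set0Pn; exists (Ordinal ln); rewrite inE /= leqnn lk.
have dis : [disjoint ord_segment l k & ord_segment 0 l].
  rewrite -setI_eq0; apply/eqP/setP => i; rewrite !inE /=.
  by rewrite andbAC [X in X && _]andbC ltnNge; case: (l <= i)%N.
split.
  apply: contraNN S0 => Spi; move: dis; rewrite -setI_eq0.
  by rewrite (setIidPl (partitionS piP Spi)).
rewrite inE; apply/andP; split.
  suff -> : ord_segment 0 k = ord_segment l k :|: ord_segment 0 l.
    exact: partitionU1.
  apply/setP => i; rewrite !inE /=; case: (ltnP i l) => il; last first.
    by rewrite orbF.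
  by rewrite orbT (ltn_trans il lk).
apply/forallP => B; apply/implyP => /setU1P[->|Bpi].
  exact: ord_segment_is_interval.
exact: implyP (piI B) Bpi.
Qed.

Lemma del_last_block pi l k : (l < k)%N ->
  pi \in initial_interval_partitions k -> ord_segment l k \in pi ->
  pi :\ ord_segment l k \in initial_interval_partitions l.
Proof.
move=> lk; rewrite inE => /andP[piP /forallP piI] Spi.
rewrite inE; apply/andP; split.
  suff -> : ord_segment 0 l = ord_segment 0 k :\: ord_segment l k.
    exact: partitionD1.
  apply/setP => i; rewrite !inE /=; case: (ltnP i l) => il /=.
    by rewrite (ltn_trans il lk).
  by case: (i < k)%N.
by apply/forallP => B; apply/implyP => /setD1P[_]; apply: implyP.
Qed.

(** Removing the last block is a bijection onto the interval partitions of a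
    shorter initial segment; the sum is split according to where that block
    starts. *)
Lemma sum_last_block (K : comNzRingType) (f : {set 'I_n} -> K) k :
  (0 < k <= n)%N ->
  \sum_(pi in initial_interval_partitions k) \prod_(B in pi) f B =
  \sum_(l < k) (\sum_(pi in initial_interval_partitions l) \prod_(B in pi) f B)
     * f (ord_segment l k).
Proof.
case: k => // k /= kn.
transitivity (\sum_(pi in initial_interval_partitions k.+1)
    \sum_(l < k.+1 | ord_segment l k.+1 \in pi) \prod_(B in pi) f B).
  apply: eq_bigr => pi piP; have [l lpi lU] := last_block_exists kn piP.
  rewrite (big_pred1 l) // => l'; apply/idP/eqP => [|->//]; exact: lU.
(* For fixed l, the map pi |-> pi :\ ord_segment l k.+1 is inverse to adding
   that block. *)
rewrite (exchange_big_dep xpredT) //=; apply: eq_bigr => l _.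
rewrite mulr_suml (reindex_onto (fun pi => ord_segment l k.+1 |: pi)
  (fun pi => pi :\ ord_segment l k.+1)) /=; last first.
  by move=> pi /andP[_ lpi]; rewrite setD1K.
apply: eq_big => [pi|pi /andP[/andP[piP lpi] /eqP pi_eq]].
  apply/idP/idP => [/andP[/andP[piP lpi] /eqP <-]|piP].
    exact: del_last_block (ltn_ord l) piP lpi.
  have [lNpi ->] := add_last_block (ltn_ord l) kn piP.
  by rewrite setU11 setU1K //= eqxx.
have lNpi : ord_segment l k.+1 \notin pi by rewrite -pi_eq setD11.
by rewrite (big_setU1 _ lNpi) mulrC.
Qed.

Lemma initial_interval_partitions0 : initial_interval_partitions 0 = [set set0].
Proof.
have S0 : ord_segment 0 0 = set0 by apply/setP => i; rewrite !inE ltn0 andbF.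
apply/setP => pi; rewrite !inE S0 partition_set0.
case: eqVneq => //= ->; apply/forallP => B; by rewrite inE.
Qed.

Lemma initial_interval_partitionsT :
  initial_interval_partitions n = interval_partitions n.
Proof.
suff ST : ord_segment 0 n = [set: 'I_n] by apply/setP => pi; rewrite !inE ST.
by apply/setP => i; rewrite !inE ltn_ord.
Qed.

End LastBlock.

Lemma subword_segment d (u : seq 'I_d) l k : (k <= size u)%N ->
  subword (ord_segment (size u) l k) = drop l (take k u).
Proof.
move=> ku; rewrite /subword.
have -> : enum (ord_segment (size u) l k)
        = drop l (take k (enum 'I_(size u))).
  transitivity [seq i : 'I_(size u) <- enum 'I_(size u) | (l <= i < k)%N].
    by rewrite enumT; apply: eq_filter => i; rewrite !inE.
  apply: (inj_map val_inj).
  transitivity [seq i <- map val (enum 'I_(size u)) | (l <= i < k)%N].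
    by rewrite filter_map.
  rewrite map_drop map_take.
  rewrite val_enum_ord take_iota (minn_idPl ku) drop_iota add0n.
  apply: (irr_sorted_eq ltn_trans ltnn).
  - exact: (sorted_filter ltn_trans _ (iota_ltn_sorted _ _)).
  - exact: iota_ltn_sorted.
  move=> i; rewrite mem_filter !mem_iota add0n.
  rewrite -maxnE leq_max leqNgt; case: ltnP => //= _.
  by rewrite andb_idr // => ik; apply: leq_trans ik ku.
by rewrite map_drop map_take map_tnth_enum.
Qed.

(** * Moments and cumulants of words *)

HB.instance Definition _ (K : comNzRingType) d (A : lalgType K)
    (X : 'I_d -> A) :=
  GRing.isLinear.Build K (ncpoly K d) A *:%R (nceval X) (nceval_linear X).

HB.instance Definition _ (K : comNzRingType) d (A : lalgType K)
    (Phi : {scalar A}) (X : 'I_d -> A) :=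
  GRing.isLinear.Build K (ncpoly K d) K *%R (joint_distr Phi X)
    (joint_distr_scalar Phi X).

HB.instance Definition _ (K : comNzRingType) d (i : 'I_d) :=
  GRing.isLinear.Build K (ncpoly K d) (ncpoly K d) *:%R (@left_diff K d i)
    (left_diff_linear i).

Section Words.
Context (K : comNzRingType) (d : nat).
Implicit Types (u v : seq 'I_d).

(** The defining moment formula of [is_boolean_cumulant] sums over partitions of
    'I_(size v) with v = take k u; this transports it to partitions of an initial
    segment of the larger type 'I_(size u). Both sides satisfy the last-block
    recursion, so induction on k avoids any explicit reindexing of partitions. *)
Lemma moment_initial_segment (phi eta : ncpoly K d -> K) u k :
  phi 1 = 1 -> is_boolean_cumulant phi eta -> (k <= size u)%N ->
  phi (mon K (take k u)) =
  \sum_(pi in initial_interval_partitions (size u) k)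
    \prod_(B in pi) eta (mon K (subword B)).
Proof.
move=> phi1 etaP; have [N] := ubnP k; elim: N k u => // N IH k u kN ku.
have [k0|k0] := posnP k.
  by rewrite k0 take0 mon_nil phi1 initial_interval_partitions0 big_set1 big_set0.
set v := take k u; have sv : size v = k by rewrite size_takel.
rewrite (bc_moment etaP) -?size_eq0 ?sv -?lt0n //.
transitivity (\sum_(l < size v) phi (mon K (take l v)) * eta (mon K (drop l v))).
  rewrite -initial_interval_partitionsT sum_last_block ?sv ?k0 ?leqnn //.
  apply: eq_bigr => l _; have lv : (l < k)%N by rewrite -[X in (_ < X)%N]sv.
  rewrite -IH ?(leq_trans lv) //; last exact: ltnW.
  by rewrite subword_segment // take_size.
have reindex (F : nat -> K) : \sum_(l < size v) F l = \sum_(l < k) F l.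
  by rewrite sv.
rewrite (reindex (fun l => phi (mon K (take l v)) * eta (mon K (drop l v)))).
rewrite sum_last_block ?k0 //; apply: eq_bigr => l _; have lk := ltn_ord l.
rewrite -IH ?(leq_trans lk) ?(leq_trans (ltnW lk)) // subword_segment //.
by rewrite take_takel // ltnW.
Qed.

(** The coefficientwise form of (1 + M) (1 - eta) = 1. *)
Lemma moment_last_block (phi eta : ncpoly K d -> K) u :
  phi 1 = 1 -> is_boolean_cumulant phi eta -> (0 < size u)%N ->
  phi (mon K u) =
  \sum_(l < size u) phi (mon K (take l u)) * eta (mon K (drop l u)).
Proof.
move=> phi1 etaP u0; rewrite -{1}[u]take_size.
rewrite (moment_initial_segment phi1 etaP) // sum_last_block ?u0 ?leqnn //.
apply: eq_bigr => l _; rewrite subword_segment // take_size.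
by rewrite -(moment_initial_segment phi1 etaP) // ltnW.
Qed.

(** * Inverses of the generating series *)

(** The geometric series in x.z, that is (1 - x.z)^-1. *)
Definition word_series : ncseries d (ncpoly K d) := fun u => mon K u.

Lemma x_dot_zM_nil (F : ncseries d (ncpoly K d)) : (x_dot_z * F) [::] = 0.
Proof.
rewrite series_coefM big_ord1 /= /x_dot_z series_sumE big1 ?mul0r // => i _.
by rewrite series_coefM big_ord1 /= /zvar mulr0.
Qed.

Lemma x_dot_zM_cons (F : ncseries d (ncpoly K d)) j u :
  (x_dot_z * F) (j :: u) = mon K [:: j] * F u.
Proof.
rewrite /x_dot_z mulr_suml series_sumE (bigD1 j) //= [X in _ + X]big1.
  rewrite addr0 -mulrA [LHS]series_coefM big_ord_recl take0 drop0 /=.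
  rewrite big1 ?addr0 => [|k _]; last by rewrite /= mul0r.
  rewrite series_coefM big_ord_recl take0 /= /zvar mul0r add0r.
  rewrite big_ord_recl /= take0 drop0 eqxx mul1r big1 ?addr0 // => k _.
  case: u k => [|i u] [k kP] //=.
  by rewrite eqseq_cons andbF mul0r.
move=> i /negPf ij; rewrite -mulrA series_coefM big_ord_recl take0 drop0 /=.
rewrite big1 ?addr0 => [|k _]; last by rewrite /= mul0r.
rewrite series_coefM big1 ?mulr0 // => k _; rewrite /zvar.
case: k => [[|k] kP] /=; first by rewrite mul0r.
by rewrite eqseq_cons eq_sym ij mul0r.
Qed.

Lemma invr_series_const1 (F G : ncseries d (ncpoly K d)) :
  F [::] = 1 -> F * G = 1 -> F^-1 = G.
Proof. by move=> /series_unit_const1 Fu FG; rewrite -[RHS](mulKr Fu) FG mulr1. Qed.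

(** Multiplying by x.z prepends a letter, so x.z W is W without its constant
    term, where W is the series of all words. *)
Lemma inv_1B_x_dot_z : (1 - x_dot_z)^-1 = word_series.
Proof.
apply: invr_series_const1.
  by rewrite series_coefD series_coefN -[x_dot_z]mulr1 x_dot_zM_nil subr0.
rewrite mulrBl mul1r; apply/funext => -[|j u]; rewrite series_coefD series_coefN.
  by rewrite x_dot_zM_nil subr0 series_coef1 /word_series mon_nil.
by rewrite x_dot_zM_cons /word_series -(mon_cat _ [:: j]) subrr.
Qed.

Lemma moment_seriesE (phi : ncpoly K d -> K) u : phi 1 = 1 ->
  (1 + moment_series phi) u = (phi (mon K u))%:MP.
Proof.
move=> phi1; rewrite series_coefD series_coef1; case: u => [|j u] /=.
  by rewrite mon_nil phi1 mpolyC1E addr0.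
by rewrite add0r.
Qed.

(** A right inverse of a unit is its inverse, so only the last-block identity is
    used; the first-block identity comes out of the unit ring structure. *)
Lemma inv_1D_moment_series (phi : ncpoly K d -> K) : phi 1 = 1 ->
  (1 + moment_series phi)^-1 = 1 - cumulant_series phi.
Proof.
move=> phi1; apply: invr_series_const1.
  by rewrite (moment_seriesE _ phi1) mon_nil phi1 mpolyC1E.
apply/funext => u; rewrite series_coefM big_ord_recr /= take_size drop_size.
rewrite !moment_seriesE // series_coefD series_coefN series_coef1 /= subr0 mulr1.
have [->|u0] := eqVneq u [::].
  by rewrite big_ord0 add0r mon_nil phi1 mpolyC1E.
have su0 : (0 < size u)%N by rewrite lt0n size_eq0.
rewrite (moment_last_block phi1 (boolean_cumulantP phi) su0).
rewrite raddf_sum -big_split big1 //= => l _.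
rewrite moment_seriesE // series_coefD series_coefN series_coef1.
have : drop l u != [::] by rewrite -size_eq0 size_drop subn_eq0 -ltnNge.
case: (drop l u) => // j v _ /=.
by rewrite add0r mulrN -mpolyCM addNr.
Qed.

(** * Boolean Appell polynomials *)

Lemma left_diff_subl_sum (i : 'I_d) n (P : ncpoly K d) (c : 'I_n -> K)
    (Q : 'I_n -> ncpoly K d) :
  left_diff i (P - \sum_(k < n) c k *: Q k)
  = left_diff i P - \sum_(k < n) c k *: left_diff i (Q k).
Proof.
rewrite raddfB; congr (_ - _); rewrite raddf_sum; apply: eq_bigr => k _.
exact: linearZ.
Qed.

(** The four properties reduce to: each correction term is a word shorter than u;
    D_i acts on first letters only, and its sole effect besides the shift is to
    kill the constant correction eta[x_u]; and the mean is the last-block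
    identity. *)
Lemma is_boolean_appell_expand (phi : {scalar ncpoly K d}) : phi 1 = 1 ->
  is_boolean_appell phi (fun u => mon K u -
    \sum_(k < size u)
      boolean_cumulant phi (mon K (drop k u)) *: mon K (take k u)).
Proof.
move=> phi1; split.
- by rewrite big_ord0 subr0 mon_nil.
- move=> u w; apply: contraTltn => uw.
  rewrite -mcoeff_neq0 negbK addrAC subrr add0r raddfN raddf_sum oppr_eq0.
  rewrite big1 //= => k _; rewrite mcoeffZ mcoeffU.
  case: eqP => [E|_]; last by rewrite mulr0.
  move: uw; rewrite -E /fdeg /= size_take ltn_ord leqNgt.
  by rewrite ltn_ord.
- move=> i j u; rewrite left_diff_subl_sum left_diff_cons big_ord_recl /=.
  rewrite mon_nil left_diff1 scaler0 add0r scalerBr scaler_sumr.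
  apply: congr1; apply: congr1; apply: eq_bigr => k _.
  by rewrite left_diff_cons !scalerA mulrC.
- move=> u; rewrite linearB linear_sum /=.
  have [->|u0] := eqVneq u [::]; first by rewrite big_ord0 subr0 mon_nil phi1.
  have su0 : (0 < size u)%N by rewrite lt0n size_eq0.
  rewrite (moment_last_block phi1 (boolean_cumulantP phi) su0) -sumrB big1 // => k _.
  by rewrite linearZ /= mulrC subrr.
Qed.

Lemma boolean_appellE (phi : {scalar ncpoly K d}) u : phi 1 = 1 ->
  boolean_appell phi u = mon K u -
    \sum_(k < size u)
      boolean_cumulant phi (mon K (drop k u)) *: mon K (take k u).
Proof.
move=> phi1; have lphi : scalar phi by exact: linearP.
have /(congr1 (@^~ u)) := is_boolean_appell_inj lphi phi1
  (boolean_appellP lphi phi1) (is_boolean_appell_expand phi1).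
exact.
Qed.

Lemma mulr_malgC (P : ncpoly K d) c : P * c%:MP = c *: P.
Proof.
rewrite [P]ncpoly_monE mulr_suml scaler_sumr; apply: eq_bigr => w _.
rewrite -scalerAl scalerA mulrC -scalerA; congr (_ *: _).
by rewrite -mul_malgC /mon !malgM_def !fgmulUU mulm1 mul1m mulrC.
Qed.

Lemma appell_series_coef (phi : {scalar ncpoly K d}) u : phi 1 = 1 ->
  appell_series phi u = boolean_appell phi u.
Proof.
move=> phi1; rewrite /appell_series series_coefD series_coef1.
case: u => [|j u] /=; last by rewrite add0r.
by rewrite boolean_appellE // big_ord0 subr0 addr0 mon_nil.
Qed.

Lemma appell_seriesE (phi : {scalar ncpoly K d}) : phi 1 = 1 ->
  appell_series phi = (1 - x_dot_z)^-1 * (1 - cumulant_series phi).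
Proof.
move=> phi1; apply/funext => u; rewrite inv_1B_x_dot_z series_coefM.
rewrite big_ord_recr /= take_size drop_size series_coefD series_coefN /= subr0.
rewrite mulr1 /word_series addrC.
rewrite appell_series_coef // boolean_appellE // -sumrN; congr (_ + _).
apply: eq_bigr => l _.
rewrite series_coefD series_coefN series_coef1.
have : drop l u != [::] by rewrite -size_eq0 size_drop subn_eq0 -ltnNge.
case: (drop l u) => // j v _ /=.
by rewrite add0r mulrN mulr_malgC.
Qed.

(** Coefficients of (1 - x.z)^-1 = H (1 + M). *)
Lemma mon_appell_expand (phi : {scalar ncpoly K d}) u : phi 1 = 1 ->
  mon K u = boolean_appell phi u +
    \sum_(k < size u) phi (mon K (drop k u)) *: boolean_appell phi (take k u).
Proof.
move=> phi1.
have Mu : 1 + moment_series phi \is a GRing.unit.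
  apply: series_unit_const1.
  by rewrite (moment_seriesE _ phi1) mon_nil phi1 mpolyC1E.
have : word_series = appell_series phi * (1 + moment_series phi).
  by rewrite appell_seriesE // -inv_1D_moment_series // mulrVK // inv_1B_x_dot_z.
move=> /(congr1 (@^~ u)); rewrite series_coefM big_ord_recr /=.
rewrite take_size drop_size moment_seriesE // mon_nil phi1 mulr1.
rewrite appell_series_coef // addrC.
rewrite /word_series => ->.
congr (_ + _); apply: eq_bigr => k _.
by rewrite moment_seriesE // appell_series_coef // mulr_malgC.
Qed.

End Words.

(** * Cumulants and Appell polynomials of lists of elements *)

Section Elements.
Context (K : comNzRingType) (A : lalgType K) (Phi : {scalar A})
  (Phi1 : Phi 1 = 1).
Implicit Types (s : seq A).

Lemma joint_distr_mon d (X : 'I_d -> A) u :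
  joint_distr Phi X (mon K u) = Phi (\prod_(y <- map X u) y).
Proof. by rewrite /joint_distr nceval_mon big_map. Qed.

(** The k = 0 term of the last-block identity is the cumulant of u itself, since
    the empty word has moment 1. The moments are written in terms of the
    evaluated list s, to make visible that the recursion sees X and u only
    through s. *)
Lemma boolean_cumulant_rec d (X : 'I_d -> A) u (s := map X u) : (0 < size u)%N ->
  boolean_cumulant (joint_distr Phi X) (mon K u) = Phi (\prod_(y <- s) y) -
    \sum_(k < (size s).-1) Phi (\prod_(y <- take k.+1 s) y) *
      boolean_cumulant (joint_distr Phi X) (mon K (drop k.+1 u)).
Proof.
move=> u0; rewrite -joint_distr_mon size_map.
rewrite (moment_last_block (joint_distr1 X Phi1) (boolean_cumulantP _) u0).
case: u @s u0 => // j u s _.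
rewrite big_ord_recl take0 drop0 mon_nil (joint_distr1 X Phi1) mul1r.
apply/esym/eqP; rewrite subr_eq; apply/eqP; congr (_ + _).
by apply: eq_bigr => k _; rewrite joint_distr_mon map_take.
Qed.

(** Induction on the length, as both cumulants obey the same recursion with the
    same moments. This is what relates cumulants computed from the joint
    distributions of different families. *)
Lemma boolean_cumulant_word d d' (X : 'I_d -> A) (X' : 'I_d' -> A) u u' :
  map X u = map X' u' ->
  boolean_cumulant (joint_distr Phi X) (mon K u)
  = boolean_cumulant (joint_distr Phi X') (mon K u').
Proof.
have [N] := ubnP (size u); elim: N u u' => // N IH u u' uN E.
have su : size u = size u' by rewrite -(size_map X u) E size_map.
have [/size0nil u0|u0] := posnP (size u).
  rewrite u0 /= in su; rewrite u0 (size0nil (esym su)) !mon_nil.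
  by rewrite !(bc_one (boolean_cumulantP _)).
rewrite !boolean_cumulant_rec -?su // E; congr (_ - _).
apply: eq_bigr => k _; congr (_ * _); apply: IH; last by rewrite !map_drop E.
by rewrite size_drop -ltnS (leq_trans _ uN) // !ltnS ltn_subrL u0.
Qed.

Lemma cumulant_of_map d (X : 'I_d -> A) u :
  cumulant_of Phi (map X u) = boolean_cumulant (joint_distr Phi X) (mon K u).
Proof. by apply: boolean_cumulant_word; rewrite map_tnth_enum. Qed.

Lemma nceval_boolean_appell d (X : 'I_d -> A) u (s := map X u) :
  nceval X (boolean_appell (joint_distr Phi X) u) = \prod_(y <- s) y -
    \sum_(k < size s) cumulant_of Phi (drop k s) *: \prod_(y <- take k s) y.
Proof.
have nmon v : nceval X (mon K v) = \prod_(y <- map X v) y.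
  by rewrite nceval_mon big_map.
rewrite (boolean_appellE _ (joint_distr1 X Phi1)) raddfB.
rewrite size_map; congr (_ - _); first exact: nmon.
rewrite raddf_sum; apply: eq_bigr => k _.
rewrite -map_drop -map_take cumulant_of_map -nmon; exact: linearZ.
Qed.

Lemma appell_of_expand s : appell_of Phi s = \prod_(y <- s) y -
    \sum_(k < size s) cumulant_of Phi (drop k s) *: \prod_(y <- take k s) y.
Proof. by rewrite /appell_of nceval_boolean_appell map_tnth_enum. Qed.

Lemma appell_of_map d (X : 'I_d -> A) u :
  appell_of Phi (map X u) = nceval X (boolean_appell (joint_distr Phi X) u).
Proof. by rewrite appell_of_expand nceval_boolean_appell. Qed.

Lemma prod_appell_expand s : \prod_(y <- s) y = appell_of Phi s +
    \sum_(k < size s) Phi (\prod_(y <- drop k s) y) *: appell_of Phi (take k s).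
Proof.
(* Stated for a word evaluated in a family X, the claim keeps the family fixed
   while the word is cut. *)
suff expand_map d (X : 'I_d -> A) u : \prod_(y <- map X u) y =
    appell_of Phi (map X u) + \sum_(k < size (map X u))
      Phi (\prod_(y <- drop k (map X u)) y) *: appell_of Phi (take k (map X u)).
  by have := expand_map _ (tnth (in_tuple s)) (enum 'I_(size s));
    rewrite map_tnth_enum.
rewrite big_map -nceval_mon (mon_appell_expand u (joint_distr1 X Phi1)).
rewrite raddfD size_map appell_of_map; congr (_ + _).
rewrite raddf_sum; apply: eq_bigr => k _.
rewrite -map_drop -map_take appell_of_map -joint_distr_mon; exact: linearZ.
Qed.

End Elements.

(** In the expansion for y :: s, the terms k > 0 are y times the terms of the
    expansion for s, and k = 0 is the constant cumulant. *)
Lemma mul_appell_of (K : comNzRingType) (A : algType K) (Phi : {scalar A})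
    (y : A) (s : seq A) : Phi 1 = 1 ->
  y * appell_of Phi s = appell_of Phi (y :: s) + (cumulant_of Phi (y :: s))%:A.
Proof.
move=> Phi1; rewrite !appell_of_expand // big_ord_recl /= big_nil big_cons.
rewrite opprD addrA addrAC subrK mulrBr mulr_sumr; congr (_ - _).
by apply: eq_bigr => k _; rewrite big_cons scalerAr.
Qed.

Local Open Scope complex_scope.

Theorem proposition2 (R : realType) (A : algType R[i]) (star : A -> A)
    (Phi : {scalar A}) (d : nat) (X : 'I_d -> A)
    (star_inv : star_involution star)
    (Phi_unital : Phi 1 = 1)
    (Phi_star : star_compatible star Phi)
    (X_sa : forall i, star (X i) = X i) :
  (let phi := joint_distr Phi X in
   let H := appell_series phi in
   let eta := cumulant_series phi in
   let M := moment_series phi in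
     H = (1 - x_dot_z)^-1 * (1 - eta)
     /\ (1 - x_dot_z)^-1 * (1 - eta) = (1 - x_dot_z)^-1 * (1 + M)^-1)
  /\ (forall (n : nat) (Y : n.-tuple A), (0 < n)%N ->
       (forall i, star (tnth Y i) = tnth Y i) ->
       appell_of Phi Y = \prod_(y <- Y) y
         - \sum_(k < n) cumulant_of Phi (drop k Y) *: \prod_(y <- take k Y) y
       /\ \prod_(y <- Y) y = appell_of Phi Y
         + \sum_(k < n) Phi (\prod_(y <- drop k Y) y) *: appell_of Phi (take k Y))
  /\ (forall (n : nat) (Y0 : A) (Y : n.-tuple A), star Y0 = Y0 ->
       (forall i, star (tnth Y i) = tnth Y i) ->
       Y0 * appell_of Phi Y
       = appell_of Phi (Y0 :: Y) + (cumulant_of Phi (Y0 :: Y))%:A).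
Proof.
have phi1 := joint_distr1 X Phi_unital.
split.
  by split; [exact: (appell_seriesE phi1) | rewrite inv_1D_moment_series].
split=> [n [s sP] _ _ /=|n y Y _ _]; last exact: mul_appell_of.
move/eqP: sP => <-.
by split; [exact: appell_of_expand | exact: prod_appell_expand].
Qed.
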